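(* Let $G$ be an insoluble para-$\mathfrak{Nil}$-Hamiltonian group and let $X$ be a finite non-nilpotent subgroup of $G$, with normal closure $X^G$ in $G$. (i) If $X^G$ is finite, then $G$ is finite. (ii) If $X\trianglelefteq G$, or if $X\ntrianglelefteq G$ but $X\trianglelefteq X^G$, then $G$ is finite. (iii) If $X^G$ is infinite, then $\gamma_3(G)=\gamma_\infty(G)$, and this subgroup is a finitely generated perfect insoluble group whose quotient by its Fitting subgroup is a non-abelian simple group; moreover, if $\gamma_3(G)$ is minimal non-nilpotent, then $\mathrm{Fit}(\gamma_3(G))=\Phi(\gamma_3(G))$.
   Context: A group is minimal non-nilpotent if it is not nilpotent but all its proper subgroups are nilpotent. A group $G$ is para-$\mathfrak{Nil}$-Hamiltonian if $G$ is non-nilpotent and every non-normal subgroup of $G$ is either nilpotent or minimal non-nilpotent. $X^G$ is the smallest normal subgroup of $G$ containing $X$. $\gamma_i(G)$ is the $i$-th term of the lower central series and $\gamma_\infty(G)=\bigcap_{i\ge1}\gamma_i(G)$. $\mathrm{Fit}(H)$ is the Fitting subgroup (generated by all nilpotent normal subgroups) and $\Phi(H)$ the Frattini subgroup of $H$. A group $H$ is perfect if $H=H'$. *)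

(* Defs.v *)
From Stdlib Require Import List Arith.

Record Grp := {
  gcar :> Type;
  gmul : gcar -> gcar -> gcar;
  gone : gcar;
  ginv : gcar -> gcar;
  gmulA : forall x y z, gmul x (gmul y z) = gmul (gmul x y) z;
  gmul1 : forall x, gmul gone x = x;
  gmulV : forall x, gmul (ginv x) x = gone }.

Arguments gmul {_} x y.
Arguments gone {_}.
Arguments ginv {_} x.

Definition gset (G : Grp) := G -> Prop.

Section Defs.
Variable G : Grp.

Definition sub (A B : gset G) := forall x, A x -> B x.
Definition seteq (A B : gset G) := sub A B /\ sub B A.
Definition whole : gset G := fun _ => True.
Definition trivial : gset G := fun x => x = gone.

Definition is_subgroup (H : gset G) :=
  H gone /\ (forall x y, H x -> H y -> H (gmul x y)) /\ (forall x, H x -> H (ginv x)).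

Definition gen (S : gset G) : gset G :=
  fun x => forall K, is_subgroup K -> sub S K -> K x.

Definition conjg (x g : G) : G := gmul (gmul (ginv g) x) g.
Definition commutator (x y : G) : G := gmul (gmul (gmul (ginv x) (ginv y)) x) y.
Definition commg (A B : gset G) : gset G :=
  gen (fun z => exists a b, A a /\ B b /\ z = commutator a b).

(* lcs H n = gamma_{n+1}(H) *)
Fixpoint lcs (H : gset G) (n : nat) : gset G :=
  match n with 0 => H | S m => commg (lcs H m) H end.
(* gamma H i = gamma_i(H), for i >= 1 *)
Definition gamma (H : gset G) (i : nat) : gset G := lcs H (Nat.pred i).
Definition gamma_inf (H : gset G) : gset G := fun x => forall i, 1 <= i -> gamma H i x.

Fixpoint derived (H : gset G) (n : nat) : gset G :=
  match n with 0 => H | S m => commg (derived H m) (derived H m) end.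

Definition nilpotent (H : gset G) := exists n, sub (lcs H n) trivial.
Definition soluble (H : gset G) := exists n, sub (derived H n) trivial.

Definition proper_sub (K H : gset G) := sub K H /\ ~ sub H K.

Definition minimal_non_nilpotent (H : gset G) :=
  ~ nilpotent H /\ forall K, is_subgroup K -> proper_sub K H -> nilpotent K.

Definition normal (N H : gset G) :=
  is_subgroup N /\ sub N H /\ forall n h, N n -> H h -> N (conjg n h).

Definition para_nil_hamiltonian :=
  ~ nilpotent whole /\
  forall K, is_subgroup K -> ~ normal K whole -> nilpotent K \/ minimal_non_nilpotent K.

Definition normal_closure (H X : gset G) : gset G :=
  gen (fun z => exists x h, X x /\ H h /\ z = conjg x h).

Definition finite_set (S : gset G) := exists l : list G, forall x, S x -> In x l.

Definition finitely_generated (H : gset G) :=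
  exists l : list G, seteq (gen (fun x => In x l)) H.

Definition perfect (H : gset G) := seteq (commg H H) H.

Definition Fitting (H : gset G) : gset G :=
  gen (fun x => exists N, normal N H /\ nilpotent N /\ N x).

Definition maximal_subgroup (M H : gset G) :=
  is_subgroup M /\ proper_sub M H /\
  forall K, is_subgroup K -> sub M K -> sub K H -> seteq K M \/ seteq K H.

(* Frattini subgroup: intersection of the maximal subgroups of H (H if none) *)
Definition Frattini (H : gset G) : gset G :=
  fun x => H x /\ forall M, maximal_subgroup M H -> M x.

(* H/N is a non-abelian simple group, expressed via the correspondence theorem:
   N is a proper normal subgroup of H, maximal among normal subgroups of H
   (so H/N is simple), and H' is not contained in N (so H/N is non-abelian). *)
Definition quotient_nonabelian_simple (H N : gset G) :=
  normal N H /\ proper_sub N H /\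
  (forall K, normal K H -> sub N K -> seteq K N \/ seteq K H) /\
  ~ sub (commg H H) N.
End Defs.

Arguments sub {G}. Arguments seteq {G}. Arguments whole {G}. Arguments trivial {G}.
Arguments is_subgroup {G}. Arguments gen {G}. Arguments conjg {G}. Arguments commutator {G}.
Arguments commg {G}. Arguments lcs {G}. Arguments gamma {G}. Arguments gamma_inf {G}.
Arguments derived {G}. Arguments nilpotent {G}. Arguments soluble {G}.
Arguments proper_sub {G}. Arguments minimal_non_nilpotent {G}. Arguments normal {G}.
Arguments normal_closure {G}. Arguments finite_set {G}. Arguments finitely_generated {G}.
Arguments perfect {G}. Arguments Fitting {G}. Arguments maximal_subgroup {G}.
Arguments Frattini {G}. Arguments quotient_nonabelian_simple {G}.

(* Main.v *)
From HB Require Import structures.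
From mathcomp Require Import all_boot all_fingroup all_solvable.
From mathcomp Require Import zify.
From mathcomp Require Import boolp.
From mathcomp Require classical_sets.
From Stdlib Require Import Lia.
From Stdlib Require List.

Set Implicit Arguments.
Unset Strict Implicit.
Unset Printing Implicit Defensive.

(** Write T = gamma_3(G).  A subgroup properly containing a non-nilpotent
    subgroup is neither nilpotent nor minimal non-nilpotent, hence normal.  So if
    Y is normal and non-nilpotent then G/Y is a Dedekind group; such a group has
    class at most 2, because conjugation induces commuting power maps on each
    cyclic subgroup.  Therefore T lies in every non-nilpotent normal subgroup,
    and in every proper overgroup of a non-nilpotent subgroup.

    Finite minimal non-nilpotent groups are soluble (Schmidt).  If N = X^G is
    finite and G is not, pick Y <= X minimal non-nilpotent and c in C_G(N) \ Y:
    then T <= Y<c> is soluble, a contradiction.  If X is normal in X^G but not in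
    G, then X X^g is finite, normal in G and contains X^G for a suitable g.

    If X is not normal in G, it is soluble, TX = <X, x^g> for a suitable
    conjugate x^g, and T is finitely generated by Schreier.  As T' is insoluble
    and normal, T = T'.  A proper normal subgroup N of T is nilpotent, since
    otherwise T/N would be cyclic.  A perfect group is not the product of a
    proper normal subgroup and a soluble one, so the proper normal subgroups of T
    form a directed family whose union is Fit(T), proper by finite generation. *)

(** * Schmidt's theorem *)

Section Schmidt.
Import GroupScope.
Local Notation nil := nilpotent.nilpotent.

Lemma maximal_sub_eq (gT : finGroupType) (G M N : {group gT}) :
  maximal M G -> maximal N G -> M \subset N -> M = N.
Proof.
move=> /maxgroupP[_ maxM] /maxgroupP[pN _] sMN.
by apply/val_inj; rewrite /= (maxM N pN sMN).
Qed.

Section MinimalNonNilpotent.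
Variables (gT : finGroupType) (G : {group gT}).
Hypothesis nilP : forall H : {group gT}, H \proper G -> nil H.
Hypothesis simG : forall N : {group gT}, N <| G -> N :=: 1 \/ N :=: G.
Hypothesis nnilG : ~~ nil G.

(** If the trivial subgroup were maximal, a nontrivial cyclic subgroup would be all of [G], which
    would then be abelian. *)
Lemma simple_maximal_neq1 (M : {group gT}) : maximal M G -> M :!=: 1.
Proof.
move=> /maxgroupP[pM maxM]; apply/eqP=> M1.
have [x Gx nx1] : exists2 x, x \in G & x != 1.
  by have [_ [x Gx /negP Mx]] := properP pM; exists x => //; apply/eqP=> x1;
     apply: Mx; rewrite x1.
have sxG : <[x]> \subset G by rewrite cycle_subG.
case/negP: nnilG; move: sxG; rewrite subEproper => /predU1P[<- | px].
  exact/abelian_nil/cycle_abelian.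
have /= := maxM <[x]>%G px; rewrite M1 sub1G => /(_ isT) x1.
by move: nx1; rewrite -cycle_eq1 x1 eqxx.
Qed.

(** By simplicity [M] is not normal, so its normalizer is a proper subgroup containing [M] and
    equals [M] by maximality. *)
Lemma simple_norm_maximal (M : {group gT}) (g : gT) :
  maximal M G -> g \in G -> M :^ g = M -> g \in M.
Proof.
move=> mM Gg nMg; have /maxgroupP[pM maxM] := mM; apply/negPn/negP=> nMg'.
have pN : 'N_G(M) \proper G.
  rewrite properEneq subsetIl andbT; apply/eqP=> NG.
  have nM : M <| G by rewrite /fingroup.normal proper_sub //= -NG subsetIr.
  case: (simG nM) => E; first by have := simple_maximal_neq1 mM; rewrite E eqxx.
  by move: pM; rewrite E properxx.
have /= := maxM 'N_G(M)%G pN; rewrite subsetI normG (proper_sub pM) => /(_ isT) E.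
by case/negP: nMg'; rewrite -E inE Gg; apply/normP.
Qed.

(* A largest intersection I of two maximal subgroups is properly contained in
   its normalizer in each of them, and by simplicity N_G(I) lies in a single
   maximal subgroup; maximality of I identifies all three. *)
Lemma simple_maximal_TI (M1 M2 : {group gT}) :
  maximal M1 G -> maximal M2 G -> M1 <> M2 -> M1 :&: M2 = 1.
Proof.
move=> mM1 mM2 nM12; apply/eqP/negPn/negP=> nI.
pose P (p : {group gT} * {group gT}) :=
  [&& maximal p.1 G, maximal p.2 G, p.1 != p.2 & p.1 :&: p.2 != 1].
have P0 : P (M1, M2) by rewrite /P /= mM1 mM2 nI !andbT; apply/eqP.
case: (@arg_maxnP _ (M1, M2) P (fun p => #|p.1 :&: p.2|) P0) => -[A B].
case/and4P=> /= mA mB nAB nI' maxI {M1 M2 mM1 mM2 nM12 nI P0}.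
pose I := (A :&: B)%G.
have pA : A \proper G by case/maxgroupP: mA.
have pB : B \proper G by case/maxgroupP: mB.
have pN : 'N_G(I) \proper G.
  rewrite properEneq subsetIl andbT; apply/eqP=> NG.
  have sIG : I \subset G by rewrite (subset_trans (subsetIl _ _)) ?proper_sub.
  have nIG : I <| G by rewrite /fingroup.normal sIG -NG subsetIr.
  case: (simG nIG) => E; first by move: nI'; rewrite -[_ :&: _]/(gval I) E eqxx.
  by move: (sub_proper_trans (subsetIl A B) pA); rewrite -[_ :&: _]/(gval I) E properxx.
have [NG | [C mC sNC]] := maximal_exists (proper_sub pN).
  by move: pN; rewrite NG properxx.
have key (M : {group gT}) : maximal M G -> I \proper M -> C = M.
  move=> mM pIM; apply/eqP/negPn/negP=> nCM.
  have pM : M \proper G by case/maxgroupP: mM.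
  have pI : I \proper C :&: M.
    apply: proper_sub_trans (nilpotent_proper_norm (nilP pM) pIM) _.
    rewrite subsetI subsetIl andbT (subset_trans _ sNC) //.
    by rewrite setSI ?proper_sub.
  have PC : P (C, M).
    rewrite /P /= mC mM nCM /=; apply/eqP=> E.
    by move: pI; rewrite E => /proper_sub_trans/(_ (sub1G I)); rewrite properxx.
  by have := maxI _ PC; rewrite /= leqNgt proper_card.
have pIA : I \proper A.
  rewrite properEneq subsetIl andbT; apply/eqP=> E.
  case/eqP: nAB; apply: maximal_sub_eq mA mB _.
  by rewrite -E subsetIr.
have pIB : I \proper B.
  rewrite properEneq subsetIr andbT; apply/eqP=> E.
  case/eqP: nAB; apply/esym; apply: maximal_sub_eq mB mA _.
  by rewrite -E subsetIl.
by case/eqP: nAB; rewrite -(key A mA pIA) -(key B mB pIB).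
Qed.

Lemma maximal_conjg (M : {group gT}) (g : gT) :
  g \in G -> maximal M G -> maximal (M :^ g) G.
Proof. by move=> Gg mM; rewrite -(conjGid Gg) maximalJ. Qed.

(** Distinct conjugates of [M] meet trivially and [M] is self-normalizing, so there are |G : M|
    conjugates, each contributing |M| - 1 nonidentity elements. *)
Lemma card_conjugates_maximal (M : {group gT}) :
  maximal M G -> #|class_support M^# G| = (#|G| - #|G : M|)%N.
Proof.
move=> mM; have sMG : M \subset G by apply: proper_sub; case/maxgroupP: mM.
have TI : normedTI M^# G M.
  apply/normedTI_P; split.
  - by rewrite setD_eq0 subG1 simple_maximal_neq1.
  - by rewrite subsetI sMG normsD1 ?normG.
  move=> g Gg /pred0Pn[x /andP[/setD1P[nx1 Mx]]] /=.
  rewrite mem_conjg => /setD1P[_]; rewrite -mem_conjg => Mgx.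
  apply: (simple_norm_maximal mM Gg); apply/eqP/negPn/negP=> /eqP nMg.
  have /setP/(_ x) : M :&: (M :^ g)%G = 1.
    by apply: simple_maximal_TI (maximal_conjg Gg mM) _ => // E; case: nMg; rewrite {2}E.
  by rewrite !inE Mx Mgx (negPf nx1).
rewrite (card_support_normedTI TI) -(Lagrange sMG) (cardsD1 1 M) group1.
by rewrite mulnDl mul1n addKn.
Qed.

(* Two classes of maximal subgroups would each cover at least half of the
   elements of G, and a single class does not cover G. *)
Lemma simple_minimal_non_nilpotent_false : False.
Proof.
have max_mem x : x \in G -> exists2 M : {group gT}, maximal M G & x \in M.
  rewrite -cycle_subG => /maximal_exists[E | [M mM sM]].
    by case/negP: nnilG; rewrite -E; apply/abelian_nil/cycle_abelian.
  by exists M => //; rewrite -cycle_subG.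
have half (M : {group gT}) : maximal M G ->
    2 * #|G : M| <= #|G| /\ 1 < #|G : M|.
  move=> mM; have pM : M \proper G by case/maxgroupP: mM.
  rewrite indexg_gt1 (proper_subn pM) -(Lagrange (proper_sub pM)); split=> //.
  by rewrite leq_mul2r cardG_gt1 simple_maximal_neq1 ?orbT.
have [M1 mM1 _] := max_mem 1 (group1 G).
have subU (M : {group gT}) : maximal M G -> class_support M^# G \subset G^#.
  move=> mM; have sM : M \subset G by apply: proper_sub; case/maxgroupP: mM.
  apply/subsetP=> _ /imset2P[y g /setD1P[ny1 My] Gg ->].
  by rewrite !inE conjg_eq1 ny1 groupJ // (subsetP sM).
have oG : #|G^#| = #|G|.-1 by rewrite (cardsD1 1 G) group1.
have [h1 i1] := half _ mM1.
have [x Gx nUx] : exists2 x, x \in G^# & x \notin class_support M1^# G.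
  have : class_support M1^# G \proper G^#.
    rewrite properEcard subU // card_conjugates_maximal // oG.
    by move: h1 i1 (cardG_gt0 G); lia.
  by case/properP=> _ [x]; exists x.
have [nx1 {}Gx] := setD1P Gx.
have [M2 mM2 M2x] := max_mem x Gx.
have [h2 i2] := half _ mM2.
(* A common nonidentity element would lie in conjugates of both [M1] and [M2], which must then
   coincide; so [M2] would be conjugate to [M1], and [x] would be covered by the first class. *)
have dU : class_support M1^# G :&: class_support M2^# G = set0.
  apply/setP=> y; rewrite in_set0; apply/negP=> /setIP[].
  case/imset2P=> a g /setD1P[na1 M1a] Gg -> /imset2P[b h /setD1P[nb1 M2b] Gh E].
  have Ggh : g * h^-1 \in G by rewrite groupM ?groupV.
  have E' : (M1 :^ (g * h^-1))%G = M2.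
    apply: contrapT => /(simple_maximal_TI (maximal_conjg Ggh mM1) mM2)/setP/(_ b).
    rewrite !inE M2b (negPf nb1) andbT /= mem_conjg invMg invgK conjgM -E.
    by rewrite -conjgM mulgV conjg1 M1a.
  case/negP: nUx; move: M2x; rewrite -E' /= mem_conjg => M1x.
  apply/imset2P; exists (x ^ (g * h^-1)^-1) (g * h^-1) => //.
    by rewrite !inE conjg_eq1 nx1.
  by rewrite -conjgM mulVg conjg1.
have : #|class_support M1^# G :|: class_support M2^# G| <= #|G^#|.
  by rewrite subset_leq_card // subUset !subU.
rewrite cardsU dU cards0 !card_conjugates_maximal // oG.
by move: h1 h2 i1 (cardG_gt0 G); lia.
Qed.
End MinimalNonNilpotent.

(** Induction on the order. A nontrivial proper normal subgroup is nilpotent, and the quotient by it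
    inherits the hypothesis; without such a subgroup [G] is simple, which is impossible unless [G]
    is nilpotent. *)
Theorem schmidt (gT : finGroupType) (G : {group gT}) :
  (forall H : {group gT}, H \proper G -> nil H) -> solvable G.
Proof.
move: {2}#|G| (leqnn #|G|) => n; elim: n gT G => [|n IHn] gT G.
  by rewrite leqNgt cardG_gt0.
move=> leGn nilP; have [nilG | nnilG] := boolP (nil G); first exact: nilpotent_sol.
have [/existsP[N /and3P[nN nN1 nNG]] | simG] :=
  boolP [exists N : {group gT}, [&& N <| G, N :!=: 1 & N :!=: G]].
  have pN : N \proper G by rewrite properEneq nNG normal_sub.
  rewrite (series_sol nN) (nilpotent_sol (nilP _ pN)) /=; apply: IHn.
    by rewrite -ltnS (leq_trans _ leGn) // ltn_quotient ?normal_sub.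
  move=> K pK; have [H KH sNH sHG] := inv_quotientS nN (proper_sub pK).
  rewrite KH quotient_nil // nilP // properEneq sHG andbT.
  by apply/eqP=> E; move: pK; rewrite KH E properxx.
exfalso; apply: (simple_minimal_non_nilpotent_false nilP) nnilG => N nN.
move: simG; rewrite negb_exists => /forallP/(_ N); rewrite nN /= negb_and !negbK.
by case/orP=> /eqP; [left | right].
Qed.
End Schmidt.

(* Not imported earlier: its [normal], [proper_sub], [commutator], ... would
   shadow the finite-group constants used above. *)
Require Import Defs.

(* Word identities in abstract groups *)
Declare Scope grp_scope.
Local Open Scope grp_scope.
Local Notation "x ** y" := (gmul x y) (at level 40, left associativity) : grp_scope.
Local Notation "x ^v" := (ginv x) (at level 2, format "x ^v") : grp_scope.

Lemma gmulr1V (G : Grp) (x : G) : x ** x^v = gone.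
Proof.
rewrite -[x ** x^v]gmul1 -{1}(gmulV G x^v) -gmulA [x^v ** (_ ** _)]gmulA.
by rewrite gmulV gmul1 gmulV.
Qed.

Lemma gmulr1 (G : Grp) (x : G) : x ** gone = x.
Proof. by rewrite -(gmulV G x) gmulA gmulr1V gmul1. Qed.

Lemma gmulKV (G : Grp) (x y : G) : x ** (x^v ** y) = y.
Proof. by rewrite gmulA gmulr1V gmul1. Qed.

Lemma gmulVK (G : Grp) (x y : G) : x^v ** (x ** y) = y.
Proof. by rewrite gmulA gmulV gmul1. Qed.

Lemma ginv_unique (G : Grp) (x y : G) : x ** y = gone -> x^v = y.
Proof. by move=> E; rewrite -[y](gmulVK x) E gmulr1. Qed.

Lemma ginv1 (G : Grp) : (@gone G)^v = gone.
Proof. by apply: ginv_unique; rewrite gmul1. Qed.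

Lemma ginvK (G : Grp) (x : G) : x^v^v = x.
Proof. by apply: ginv_unique; rewrite gmulV. Qed.

Lemma ginvM (G : Grp) (x y : G) : (x ** y)^v = y^v ** x^v.
Proof. by apply: ginv_unique; rewrite -gmulA gmulKV gmulr1V. Qed.

(* Complete rewriting system for free groups: it decides word identities. *)
Ltac group := rewrite /conjg /commutator;
  rewrite ?(ginvM, ginvK, ginv1, gmul1, gmulr1);
  rewrite -?gmulA;
  rewrite ?(gmulKV, gmulVK, gmulV, gmulr1V, gmul1, gmulr1).

(** * Subgroups, commutators and congruences *)

Section Subgroups.
Variable G : Grp.
Implicit Types (A B H K N S : gset G) (x y z : G).

Lemma sub_trans B A C : sub A B -> sub B C -> sub A C.
Proof. by move=> sAB sBC x /sAB/sBC. Qed.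

Lemma whole_subgroup : is_subgroup (@whole G).
Proof. by split; [|split]. Qed.

Lemma gen_subgroup S : is_subgroup (gen S).
Proof.
split; first by move=> K [].
split=> [x y Sx Sy K sK sSK | x Sx K sK sSK]; have [_ [kM kV]] := sK.
  by apply: kM; [apply: Sx | apply: Sy].
by apply: kV; apply: Sx.
Qed.

Lemma mem_gen S : sub S (gen S).
Proof. by move=> x Sx K _; apply. Qed.

Lemma gen_sub S K : is_subgroup K -> sub S K -> sub (gen S) K.
Proof. by move=> sK sSK x; apply. Qed.

Lemma commg_subgroup A B : is_subgroup (commg A B).
Proof. exact: gen_subgroup. Qed.

Lemma commutator_in_commg A B a b : A a -> B b -> commg A B (commutator a b).
Proof. by move=> Aa Bb; apply: mem_gen; exists a, b. Qed.

Lemma commg_sub A B K : is_subgroup K ->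
  (forall a b, A a -> B b -> K (commutator a b)) -> sub (commg A B) K.
Proof. by move=> sK sAB; apply: gen_sub => // _ [a [b [Aa [Bb ->]]]]; apply: sAB. Qed.

Lemma commg_mono A A' B B' : sub A A' -> sub B B' -> sub (commg A B) (commg A' B').
Proof.
move=> sA sB; apply: commg_sub; first exact: commg_subgroup.
by move=> a b /sA Aa /sB Bb; apply: commutator_in_commg.
Qed.

Lemma lcs_mono A B n : sub A B -> sub (lcs A n) (lcs B n).
Proof. by move=> sAB; elim: n => [|n IHn] //=; apply: commg_mono. Qed.

Lemma derived_mono A B n : sub A B -> sub (derived A n) (derived B n).
Proof. by move=> sAB; elim: n => [|n IHn] //=; apply: commg_mono. Qed.

Lemma nilpotent_mono A B : sub A B -> nilpotent B -> nilpotent A.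
Proof. by move=> sAB [n nB]; exists n; apply: sub_trans nB; apply: lcs_mono. Qed.

Lemma soluble_mono A B : sub A B -> soluble B -> soluble A.
Proof. by move=> sAB [n nB]; exists n; apply: sub_trans nB; apply: derived_mono. Qed.

Lemma commutator_in H a b : is_subgroup H -> H a -> H b -> H (commutator a b).
Proof. by move=> [_ [hM hV]] Ha Hb; exact (hM _ _ (hM _ _ (hM _ _ (hV _ Ha) (hV _ Hb)) Ha) Hb). Qed.

Lemma conjg_in H a b : is_subgroup H -> H a -> H b -> H (conjg a b).
Proof. by move=> [_ [hM hV]] Ha Hb; exact (hM _ _ (hM _ _ (hV _ Hb) Ha) Hb). Qed.

Lemma derived_subgroup H n : is_subgroup H -> is_subgroup (derived H n).
Proof. by case: n => [|n] // _; apply: commg_subgroup. Qed.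

Lemma lcs_subgroup H n : is_subgroup H -> is_subgroup (lcs H n).
Proof. by case: n => [|n] // _; apply: commg_subgroup. Qed.

Lemma derived_sub H n : is_subgroup H -> sub (derived H n) H.
Proof.
move=> sH; elim: n => [|n IHn] //=; apply: commg_sub => // a b /IHn Ha /IHn Hb.
exact: commutator_in.
Qed.

Lemma derived_lcs H n : is_subgroup H -> sub (derived H n) (lcs H n).
Proof.
move=> sH; elim: n => [|n IHn] //=; apply: commg_mono => //.
exact: derived_sub.
Qed.

Lemma nilpotent_soluble H : is_subgroup H -> nilpotent H -> soluble H.
Proof. by move=> sH [n nH]; exists n; apply: sub_trans nH; apply: derived_lcs. Qed.

Lemma derived_derived H m n : derived (derived H m) n = derived H (n + m).
Proof. by elim: n => [|n IHn] //=; rewrite IHn. Qed.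

Lemma soluble_derived H m : soluble (derived H m) -> soluble H.
Proof. by case=> n; rewrite derived_derived; exists (n + m)%N. Qed.

Lemma conjg_commutator x y g :
  conjg (commutator x y) g = commutator (conjg x g) (conjg y g).
Proof. by group. Qed.

Lemma preim_conjg_subgroup H g : is_subgroup H -> is_subgroup (fun x => H (conjg x g)).
Proof.
move=> [h1 [hM hV]]; split; first by rewrite /conjg gmulr1 gmulV.
split=> [x y Hx Hy | x Hx].
  by have := hM _ _ Hx Hy; group.
by have := hV _ Hx; group.
Qed.

Lemma normal_commg A B H : is_subgroup H ->
  normal A H -> normal B H -> normal (commg A B) H.
Proof.
move=> sH [sA [sAH nA]] [sB [sBH nB]]; split; first exact: commg_subgroup.
split; first by apply: commg_sub => // a b /sAH Ha /sBH Hb; apply: commutator_in.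
move=> n h nn Hh; move: n nn.
apply: (commg_sub (preim_conjg_subgroup h (commg_subgroup A B))) => a b Aa Bb.
by rewrite conjg_commutator; apply: commutator_in_commg; auto.
Qed.

Lemma normal_refl H : is_subgroup H -> normal H H.
Proof. by move=> sH; split=> //; split=> // n h; apply: conjg_in. Qed.

Lemma normal_lcs H n : is_subgroup H -> normal (lcs H n) H.
Proof.
move=> sH; elim: n => [|n IHn]; first exact: normal_refl.
by apply: normal_commg => //; apply: normal_refl.
Qed.

Lemma setmul_subgroup A B : is_subgroup A -> is_subgroup B ->
  (forall a b, A a -> B b -> A (conjg a b)) ->
  is_subgroup (fun x => exists a b, A a /\ B b /\ x = a ** b).
Proof.
move=> [a1 [aM aV]] [b1 [bM bV]] nAB; split.
  by exists gone, gone; rewrite gmul1.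
split=> [_ _ [a [b [Aa [Bb ->]]]] [c [d [Ac [Bd ->]]]] | _ [a [b [Aa [Bb ->]]]]].
  exists (a ** conjg c b^v), (b ** d); split; first by auto.
  by split; [auto | group].
exists (conjg a^v b), b^v; split; first by auto.
by split; [auto | group].
Qed.

(* Words in one letter: evaluating them gives the integer powers of [x]. *)
Inductive word := Wx | W1 | Wmul of word & word | Winv of word.

Fixpoint ev (w : word) (x : G) : G :=
  match w with
  | Wx => x | W1 => gone | Wmul u v => ev u x ** ev v x | Winv u => (ev u x)^v
  end.

Definition commute x y := x ** y = y ** x.

Lemma commute_ev w x y : commute x y -> commute (ev w x) y.
Proof.
rewrite /commute => E; elim: w => [||u IHu v IHv|u IHu] /=.
- by [].
- by rewrite gmul1 gmulr1.
- by rewrite -gmulA IHv gmulA IHu gmulA.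
by have := congr1 (fun z => (ev u x)^v ** z ** (ev u x)^v) IHu; group.
Qed.

Lemma commute_ev2 u v x y : commute x y -> commute (ev u x) (ev v y).
Proof. by move=> E; apply: commute_ev; apply/esym/commute_ev. Qed.

Lemma ev_mul w x y : commute x y -> ev w (x ** y) = ev w x ** ev w y.
Proof.
move=> E; elim: w => [||u IHu v IHv|u IHu] //=; first by rewrite gmul1.
  rewrite IHu IHv -!gmulA; congr (_ ** _); rewrite !gmulA; congr (_ ** _).
  by apply/esym; apply: commute_ev2.
by rewrite IHu (commute_ev2 u u E) ginvM.
Qed.

Lemma ev_one w : ev w gone = gone.
Proof.
by elim: w => [||u IHu v IHv|u IHu] //=; rewrite ?IHu ?IHv ?gmul1 ?ginv1.
Qed.

Lemma ev_inv w x : ev w x^v = (ev w x)^v.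
Proof.
apply/esym/ginv_unique; rewrite -ev_mul ?gmulr1V ?ev_one //.
by rewrite /commute gmulr1V gmulV.
Qed.

(** Evaluating [v] is multiplicative on commuting elements, and powers of [x] commute, so induction
    on [u] applies. *)
Lemma ev_ev u v x : ev u (ev v x) = ev v (ev u x).
Proof.
elim: u => [||u IHu w IHw|u IHu] /=.
- by [].
- by rewrite ev_one.
- by rewrite IHu IHw ev_mul //; apply: commute_ev2.
by rewrite IHu ev_inv.
Qed.

Lemma ev_conjg w x g : ev w (conjg x g) = conjg (ev w x) g.
Proof. by elim: w => [||u IHu v IHv|u IHu] //=; rewrite ?IHu ?IHv; group. Qed.

Lemma ev_in H w x : is_subgroup H -> H x -> H (ev w x).
Proof. by move=> [h1 [hM hV]] Hx; elim: w => [||u IHu v IHv|u IHu] /=; auto. Qed.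

(** Equality of cosets of [K]: it allows computing in a quotient without constructing it. *)
Definition cong K x y := K (x^v ** y).

Section Cong.
Variables (K H : gset G).
Hypotheses (nK : normal K H) (sH : is_subgroup H).

Lemma cong_refl x : cong K x x.
Proof. by case: nK => [[k1 _] _]; rewrite /cong gmulV. Qed.

Lemma cong_sym x y : cong K x y -> cong K y x.
Proof. by case: nK => [[_ [_ kV]] _] /kV; rewrite /cong ginvM ginvK. Qed.

Lemma cong_trans y x z : cong K x y -> cong K y z -> cong K x z.
Proof.
case: nK => [[_ [kM _]] _] Kxy Kyz.
by move: (kM _ _ Kxy Kyz); rewrite /cong; group.
Qed.

Lemma cong_mul x x' y y' : H y -> cong K x x' -> cong K y y' -> cong K (x ** y) (x' ** y').
Proof.
case: nK => [[_ [kM _]] [_ nKH]] Hy Kx Ky.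
by move: (kM _ _ (nKH _ _ Kx Hy) Ky); rewrite /cong; group.
Qed.

Lemma cong_inv x x' : H x -> cong K x x' -> cong K x^v x'^v.
Proof.
case: nK => [[_ [kM kV]] [_ nKH]] Hx Kx; have [_ [_ hV]] := sH.
by move: (nKH _ _ (kV _ Kx) (hV _ Hx)); rewrite /cong; group.
Qed.

Lemma cong_conjg x x' g : H g -> cong K x x' -> cong K (conjg x g) (conjg x' g).
Proof.
by case: nK => [_ [_ nKH]] Hg Kx; move: (nKH _ _ Kx Hg); rewrite /cong; group.
Qed.

Lemma cong_ev w x y : H x -> cong K x y -> cong K (ev w x) (ev w y).
Proof.
move=> Hx Kxy; elim: w => [||u IHu v IHv|u IHu] //=.
- exact: cong_refl.
- by apply: cong_mul => //; apply: ev_in.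
by apply: cong_inv => //; apply: ev_in.
Qed.

Definition adjoin x : gset G := gen (fun y => K y \/ y = x).

(** Modulo [K] the adjoined subgroup is cyclic, with words playing the role of exponents. *)
Lemma adjoin_cong t u : H t -> adjoin t u -> H u /\ exists w, cong K (ev w t) u.
Proof.
move=> Ht; apply: (@gen_sub _ (fun u => H u /\ exists w, cong K (ev w t) u)) => [|{}u].
  have [h1 [hM hV]] := sH; split; first by split=> //; exists W1; apply: cong_refl.
  split=> [x y [Hx [v Kv]] [Hy [w Kw]] | x [Hx [v Kv]]].
    by split; [auto|exists (Wmul v w); apply: cong_mul => //; apply: ev_in].
  by split; [auto|exists (Winv v); apply: cong_inv => //; apply: ev_in].
case=> [Ku | ->]; last by split=> //; exists Wx; apply: cong_refl.
have [_ [sKH _]] := nK.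
by split; [exact: sKH | exists W1; rewrite /cong /= ginv1 gmul1].
Qed.

(** [H] is cyclic modulo [K], hence abelian modulo [K]. *)
Lemma commg_sub_adjoin t : H t -> sub H (adjoin t) -> sub (commg H H) K.
Proof.
move=> Ht sHt; have [sK _] := nK; apply: commg_sub => // a b Ha Hb.
have [_ [v Kv]] := adjoin_cong Ht (sHt _ Ha).
have [_ [w Kw]] := adjoin_cong Ht (sHt _ Hb).
have [Hv Hw] : H (ev v t) /\ H (ev w t) by split; apply: ev_in.
have E : cong K (b ** a) (a ** b).
  apply: (@cong_trans (ev w t ** ev v t)).
    by apply: cong_mul => //; apply: cong_sym.
  by rewrite [_ ** _](@commute_ev2 w v t t) //; apply: cong_mul.
by move: E; rewrite /cong; group.
Qed.

Lemma mem_adjoin t : adjoin t t.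
Proof. by apply: mem_gen; right. Qed.

Lemma sub_adjoin t : sub K (adjoin t).
Proof. by move=> x Kx; apply: mem_gen; left. Qed.

End Cong.

(* Conjugations by [y] and [z] induce power maps on the cyclic group [K<x>/K],
   and power maps commute. *)
Lemma gamma3_sub_of_overgroups_normal K : normal K whole ->
  (forall L, is_subgroup L -> sub K L -> normal L whole) -> sub (gamma whole 3) K.
Proof.
move=> nK nL; have sW := whole_subgroup; have [sK [_ nKW]] := nK.
have powP x g : exists w, cong K (ev w x) (conjg x g).
  have [_ [_ nA]] := nL _ (gen_subgroup _) (@sub_adjoin K x).
  by have [] := adjoin_cong nK sW (t := x) I (nA x g (@mem_adjoin K x) I).
have conjC x y z : cong K (conjg (conjg x z) y) (conjg (conjg x y) z).
  have [v Kv] := powP x y; have [w Kw] := powP x z.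
  apply: (cong_trans nK) (cong_conjg nK (g := z) I Kv).
  apply: (cong_trans nK) (cong_sym nK (cong_conjg nK (g := y) I Kw)) _.
  rewrite -!ev_conjg; apply: (cong_trans nK) (cong_sym nK (cong_ev nK sW w I Kv)) _.
  by rewrite ev_ev; apply: (cong_ev nK sW).
have [k1 [kM kV]] := sK.
(* The elements that act trivially by conjugation modulo [K] form a subgroup; it contains every
   commutator because conjugations commute modulo [K]. *)
have s2 : sub (commg whole whole) (fun c => forall x, cong K x (conjg x c)).
  apply: commg_sub => [|y z _ _ x].
    split; first by move=> x; rewrite /cong; group.
    split=> [c d Kc Kd x | c Kc x].
      apply: (cong_trans nK) (Kd x) _.
      have -> : conjg x (c ** d) = conjg (conjg x c) d by group.
      exact: (cong_conjg nK).
    apply: (cong_sym nK); have := cong_conjg nK (g := c^v) I (Kc x).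
    by have -> : conjg (conjg x c) c^v = x by group.
  (* Conjugating by (zy)^-1 first turns one side into [x] and the other into the conjugate of [x] by
     [commutator y z]. *)
  have := conjC (conjg x (z ** y)^v) y z.
  by congr (cong K _ _); group.
apply: commg_sub => // c x /s2 Kc _.
have := kV _ (Kc x); rewrite /cong.
by group.
Qed.

End Subgroups.

(** * Finite subgroups as finite group types *)

Section FiniteSubgroupType.
Variables (G : Grp) (X : gset G) (sX : is_subgroup X) (fX : finite_set X).

(** Both proofs are parameters, so that the finite and group structures built from them can be
    inferred from the type. *)
Definition fin_subgroup of is_subgroup X & finite_set X : Type := {x : G | X x}.
Local Notation T := (fin_subgroup sX fX).

Let elems : list G := projT1 (cid fX).

Lemma fin_subgroup_nth (x : T) : exists k : 'I_(size elems), nth gone elems k = sval x.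
Proof.
have [k [lk E]] := List.In_nth _ _ gone (projT2 (cid fX) _ (proj2_sig x)).
have lk' : (k < size elems)%N by apply/ltP.
have nthE l i : nth gone l i = List.nth i l gone :> G.
  by elim: l i => [|a l IHl] [|i] //=.
by exists (Ordinal lk'); rewrite nthE.
Qed.

Definition fin_subgroup_index (x : T) : 'I_(size elems) := projT1 (cid (fin_subgroup_nth x)).

(** Partial, since the covering list may contain elements outside [X]. *)
Definition fin_subgroup_elt (k : 'I_(size elems)) : option T :=
  if pselect (X (nth gone elems k)) is left Xk then Some (exist _ _ Xk) else None.

Lemma fin_subgroup_val_inj (x y : T) : sval x = sval y -> x = y.
Proof. by case: x y => [x Xx] [y Xy] /= E; apply: eq_exist. Qed.

Lemma fin_subgroup_indexK : pcancel fin_subgroup_index fin_subgroup_elt.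
Proof.
move=> x; rewrite /fin_subgroup_elt /fin_subgroup_index.
case: (cid _) => k /= E; case: pselect => [Xk | []].
  by congr Some; apply: fin_subgroup_val_inj.
by rewrite E; case: x {E}.
Qed.

HB.instance Definition _ := Finite.copy T (pcan_type fin_subgroup_indexK).

Let mulT (x y : T) : T := exist _ _ (sX.2.1 _ _ (proj2_sig x) (proj2_sig y)).
Let oneT : T := exist _ _ sX.1.
Let invT (x : T) : T := exist _ _ (sX.2.2 _ (proj2_sig x)).

Lemma fin_subgroup_mulA : associative mulT.
Proof. by move=> x y z; apply: fin_subgroup_val_inj; apply: gmulA. Qed.

Lemma fin_subgroup_mul1 : left_id oneT mulT.
Proof. by move=> x; apply: fin_subgroup_val_inj; apply: gmul1. Qed.

Lemma fin_subgroup_mulV : left_inverse oneT invT mulT.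
Proof. by move=> x; apply: fin_subgroup_val_inj; apply: gmulV. Qed.

HB.instance Definition _ :=
  Finite_isGroup.Build T fin_subgroup_mulA fin_subgroup_mul1 fin_subgroup_mulV.

Definition fimage (A : {set T}) : gset G := fun z => exists2 x : T, x \in A & z = sval x.

Lemma mem_fimage (A : {set T}) (x : T) : fimage A (sval x) <-> x \in A.
Proof. by split=> [[y Ay /fin_subgroup_val_inj->] | Ax]; last exists x. Qed.

Lemma fimage_subgroup (A : {group T}) : is_subgroup (fimage A).
Proof.
split; first by exists 1%g; rewrite ?group1.
split=> [_ _ [x Ax ->] [y Ay ->] | _ [x Ax ->]].
  by exists (x * y)%g; rewrite ?groupM.
by exists (x^-1)%g; rewrite ?groupV.
Qed.

Lemma val_commg (x y : T) : sval [~ x, y]%g = commutator (sval x) (sval y).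
Proof. by rewrite /commutator -!gmulA. Qed.

Lemma fpreim_group_set (H : gset G) : is_subgroup H ->
  group_set [set x : T | `[< H (sval x) >]].
Proof.
move=> [h1 [hM _]]; apply/group_setP; split; first by rewrite inE; apply/asboolP.
by move=> x y; rewrite !inE => /asboolP Hx /asboolP Hy; apply/asboolP/hM.
Qed.

Lemma fimage_commg (A B : {set T}) (C D : gset G) :
  sub (fimage A) C -> sub (fimage B) D -> sub (fimage [~: A, B]%g) (commg C D).
Proof.
move=> sAC sBD _ [x ABx ->].
have : [~: A, B]%g \subset Group (fpreim_group_set (commg_subgroup C D)).
  rewrite gen_subG; apply/subsetP=> _ /imset2P[a b Aa Bb ->].
  rewrite inE; apply/asboolP; rewrite val_commg; apply: commutator_in_commg.
    by apply: sAC; apply/mem_fimage.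
  by apply: sBD; apply/mem_fimage.
by move/subsetP/(_ x ABx); rewrite inE => /asboolP.
Qed.

Lemma commg_fimage (A B : {set T}) (C D : gset G) :
  sub C (fimage A) -> sub D (fimage B) -> sub (commg C D) (fimage [~: A, B]%g).
Proof.
move=> sCA sDB; apply: commg_sub; first exact: fimage_subgroup.
move=> _ _ /sCA[a Aa ->] /sDB[b Bb ->]; rewrite -val_commg.
by apply/mem_fimage; apply: mem_commg.
Qed.

Lemma nilpotent_fimage (A : {group T}) : nilpotent (fimage A) -> nilpotent.nilpotent A.
Proof.
case=> n nA; apply/lcnP; exists n; apply/trivgP/subsetP=> x Lx.
(* The indices differ by one: ['L_1(A)] is [A], as is [lcs] at 0. *)
have sL : sub (fimage 'L_n.+1(A)%g) (lcs (fimage A) n).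
  by elim: {x Lx nA}n => [|n IHn] //=; apply: fimage_commg.
have /nA E : lcs (fimage A) n (sval x) by apply: sL; apply/mem_fimage.
by rewrite inE; apply/eqP/fin_subgroup_val_inj; rewrite E.
Qed.

Lemma soluble_fimage (A : {group T}) : solvable A -> soluble (fimage A).
Proof.
case/derivedP=> n sA; exists n.
have sD : sub (derived (fimage A) n) (fimage A^`(n)%g).
  by elim: {sA}n => [|n IHn] //=; apply: commg_fimage.
by move=> x /sD[y]; rewrite sA => /set1P-> ->.
Qed.

(** Schmidt's theorem, transferred through the finite group type carried by [X]. *)
Lemma minimal_non_nilpotent_soluble : minimal_non_nilpotent X -> soluble X.
Proof.
move=> [_ nilX]; have sXT : sub X (fimage [set: T]).
  by move=> x Xx; exists (exist _ x Xx : T); rewrite ?inE.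
apply: (soluble_mono sXT); apply: soluble_fimage; apply: schmidt => H pH.
apply: nilpotent_fimage; apply: nilX; first exact: fimage_subgroup.
split; first by move=> _ [[x Xx] _ ->].
have [_ [x _ Hx]] := properP pH; move/negP: Hx => Hx /(_ _ (proj2_sig x)).
by move/mem_fimage.
Qed.

End FiniteSubgroupType.

(** * Finiteness arguments *)

Section FiniteSets.
Variable G : Grp.
Implicit Types (A B X Y S R T : gset G).

Lemma finite_sub A B : sub A B -> finite_set B -> finite_set A.
Proof. by move=> sAB [l lB]; exists l => x /sAB/lB. Qed.

(** [finite_set] only provides a covering list; it is filtered classically. *)
Lemma finite_exact A : finite_set A -> exists l, forall x, A x <-> List.In x l.
Proof.
case=> l lA; have [m mP] : exists m, forall x, List.In x m <-> A x /\ List.In x l.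
  elim: l {lA} => [|a l [m mP]]; first by exists Datatypes.nil => x; split=> [|[]].
  have [Aa | nAa] := pselect (A a).
    exists (a :: m) => x /=; split.
      by case=> [<- | /mP[]]; auto.
    by case=> Ax [->|lx]; [left | right; apply/mP].
  exists m => x; split=> [/mP[Ax lx] | [Ax]]; first by split; last right.
  by case=> [E | lx]; [rewrite -E in Ax | apply/mP].
by exists m => x; split=> [Ax | /mP[]//]; apply/mP; split; last exact: lA.
Qed.

Lemma finite_union A B : finite_set A -> finite_set B ->
  finite_set (fun x => A x \/ B x).
Proof.
move=> [l lA] [m mB]; exists (l ++ m) => x ABx; apply/List.in_or_app.
by case: ABx; auto.
Qed.

Lemma finite_singleton a : finite_set (fun x : G => x = a).
Proof. by exists [:: a] => x ->; left. Qed.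

Lemma finite_setmul A B : finite_set A -> finite_set B ->
  finite_set (fun x => exists a b, A a /\ B b /\ x = a ** b).
Proof.
move=> [l lA] [m mB]; exists (List.map (fun p => p.1 ** p.2) (List.list_prod l m)).
move=> _ [a [b [/lA la [/mB mb ->]]]].
by apply/List.in_map_iff; exists (a, b); split=> //; apply/List.in_prod.
Qed.

Lemma finite_map (f : G -> G) A : finite_set A ->
  finite_set (fun x => exists2 a, A a & x = f a).
Proof. by move=> [l lA]; exists (List.map f l) => _ [a /lA la ->]; apply: List.in_map. Qed.

(** Descent on the length of a covering list: a proper non-nilpotent subgroup misses some [x], which
    can be deleted from the list. *)
Lemma exists_minimal_non_nilpotent X :
  is_subgroup X -> finite_set X -> ~ nilpotent X ->
  exists Y, [/\ is_subgroup Y, sub Y X & minimal_non_nilpotent Y].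
Proof.
move=> sX [l lX]; move: {2}(List.length l) (leqnn (List.length l)) => n.
elim: n l X sX lX => [|n IHn] l X sX lX leln nX.
  by case: l leln lX => [|//] _ lX; case: (lX gone sX.1).
have [mX | nmX] := pselect (minimal_non_nilpotent X); first by exists X; split.
have [K [sK [[sKX nXK] nK]]] :
    exists K, is_subgroup K /\ proper_sub K X /\ ~ nilpotent K.
  apply: contrapT => nex; apply: nmX; split=> // K sK pK; apply: contrapT => nK.
  by apply: nex; exists K.
have [x [Xx nKx]] : exists x, X x /\ ~ K x.
  apply: contrapT => nex; apply: nXK => x Xx; apply: contrapT => nKx.
  by apply: nex; exists x.
have [l1 [l2 El]] := List.in_split _ _ (lX _ Xx).
have [||Y [sY sYK mY]] := IHn (l1 ++ l2) K sK _ _ nK.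
- move=> y Ky; have := lX _ (sKX _ Ky); rewrite El => ly; case: (List.in_app_or _ _ _ ly) => [{}ly | [E | {}ly]].
  + by apply/List.in_or_app; left.
  + by case: nKx; rewrite E.
  by apply/List.in_or_app; right.
- by move: leln; rewrite El !List.length_app /=; lia.
by exists Y; split=> // y /sYK/sKX.
Qed.

(** The centralizer of finitely many elements with finite conjugacy classes has finite index; [R]
    contains representatives of its right cosets. *)
Lemma finite_cocentralizer (l : list G) :
  (forall x, List.In x l -> finite_set (fun y => exists g, y = conjg x g)) ->
  exists R : list G, forall g, exists c r,
    [/\ List.In r R, g = c ** r & forall x, List.In x l -> conjg x c = x].
Proof.
elim: l => [|x l IHl] fl.
  by exists [:: gone] => g; exists g, gone; split=> //; [left | rewrite gmulr1].
have [R RP] := IHl (fun y ly => fl y (or_intror ly)).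
have [k kP] := fl x (or_introl erefl).
pose C c := forall y, List.In y l -> conjg y c = y.
(* [D] selects one element of [C] for each value in [k] that [x] attains under conjugation by [C].
   If [c] and [d] give the same value, then [c ** d^v] also fixes [x]. *)
have [D DP] : exists D : list G, forall c, C c -> List.In (conjg x c) k ->
    exists d, [/\ List.In d D, C d & conjg x d = conjg x c].
  elim: k {kP} => [|v k [D DP]]; first by exists Datatypes.nil.
  have [[d [Cd dv]] | nd] := pselect (exists d, C d /\ conjg x d = v).
    exists (d :: D) => c Cc /= [E | kc].
      by exists d; split=> //; [left | rewrite dv].
    by have [e [De Ce E]] := DP _ Cc kc; exists e; split=> //; right.
  exists D => c Cc /= [E | kc]; last exact: DP.
  by case: nd; exists c.
exists (List.map (fun p => p.1 ** p.2) (List.list_prod D R)) => g.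
have [c [r [Rr -> Cc]]] := RP g.
have [|d [Dd Cd E]] := DP c Cc _; first by apply: kP; exists c.
exists (c ** d^v), (d ** r); split.
- by apply/List.in_map_iff; exists (d, r); split=> //; apply/List.in_prod.
- by group.
have conjV y : conjg y d = conjg y c -> conjg y (c ** d^v) = y.
  move=> Ey; have -> : conjg y (c ** d^v) = conjg (conjg y c) d^v by group.
  by rewrite -Ey; group.
by move=> y [<- | ly]; apply: conjV => //; rewrite Cc // Cd.
Qed.

(** Schreier's argument: with [R] covering the right cosets of [T] in [gen S], the products r s
    r'^-1 lying in [T] generate it, up to the correction made in [L]. *)
Lemma schreier S R T : finite_set S -> finite_set R -> is_subgroup T ->
  sub R (gen S) ->
  (forall h, gen S h -> exists t r, [/\ T t, R r & h = t ** r]) ->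
  sub T (gen S) -> finitely_generated T.
Proof.
move=> fS fR sT sRS RP sTS; have [t1 [tM tV]] := sT.
have [g1 [gM gV]] := gen_subgroup S.
pose S' s := S s \/ exists2 a, S a & s = a^v.
(* [R] need not contain [gone], so the elements of [R] lying in [T] are added to the Schreier
   generators. *)
pose L z := T z /\ (R z \/ exists u v, (exists r s, R r /\ S' s /\ u = r ** s) /\
                               (exists2 r, R r & v = r^v) /\ z = u ** v).
have fL : finite_set L.
  apply: (@finite_sub _ (fun z => _ \/ _)) => [z [_ Lz]|]; first exact: Lz.
  apply: finite_union => //; apply: finite_setmul; last exact: finite_map.
  apply: finite_setmul => //; apply: finite_union => //; exact: finite_map.
have sS'S s : S' s -> gen S s.
  by case=> [Ss | [a Sa ->]]; [|apply: gV]; apply: mem_gen.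
pose K := gen L; have [k1 [kM kV]] : is_subgroup K := gen_subgroup L.
have sKT : sub K T by apply: gen_sub => // z [].
(* The set KR contains [gone] and is stable under right multiplication by [gen S]. Thus any [t] in
   [T] is some k r, where [r] lies in both [T] and [R], hence in [L]. *)
pose KR z := exists k r, [/\ K k, R r & z = k ** r].
have KRS z s : KR z -> S' s -> KR (z ** s).
  move=> [k [r [Kk Rr ->]]] Ss.
  have [t [r' [Tt Rr' E]]] := RP _ (gM _ _ (sRS _ Rr) (sS'S _ Ss)).
  exists (k ** t), r'; split=> //; last by rewrite -!gmulA E.
  apply: kM => //; apply: mem_gen; split=> //; right; exists (r ** s), r'^v.
  split; first by exists r, s.
  by split; [exists r' | rewrite E; group].
(* Stating stability for [h] and its inverse together makes the set of such [h] a subgroup. *)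
have KRH h : gen S h -> forall z, KR z -> KR (z ** h) /\ KR (z ** h^v).
  apply: (@gen_sub _ _ (fun h => forall z, KR z -> KR (z ** h) /\ KR (z ** h^v))).
    split; first by move=> z; rewrite ginv1 gmulr1.
    split=> [x y Hx Hy z KRz | x Hx z KRz]; last by rewrite ginvK; have [] := Hx z KRz.
    rewrite ginvM !gmulA; split; first by apply Hy; apply Hx.
    by apply Hx; apply Hy.
  by move=> s Ss z KRz; split; apply: KRS => //; [left | right; exists s].
have KR1 : KR gone.
  have [t [r [Tt Rr E]]] := RP _ g1.
  have Er : r = t^v by rewrite -(gmulVK t r) -E gmulr1.
  exists r^v, r; split=> //; last by rewrite gmulV.
  by apply: kV; apply: mem_gen; split; [rewrite Er; apply: tV | left].
have [l lP] := finite_exact fL; exists l; split.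
  by apply: gen_sub => // z /lP[].
move=> t Tt; have [] := KRH t (sTS _ Tt) _ KR1; rewrite gmul1 => -[k [r [Kk Rr E]]] _.
have Tr : T r by rewrite -(gmulVK k r) -E; apply: tM => //; apply/tV/sKT.
have sKl : sub K (gen (fun x => List.In x l)).
  by apply: gen_sub; [exact: gen_subgroup | move=> x /lP; apply: mem_gen].
rewrite E; apply: sKl; apply: kM => //; apply: mem_gen.
by split=> //; left.
Qed.

End FiniteSets.

(** * Fitting and Frattini subgroups of perfect groups *)

Section Fitting.
Variable G : Grp.
Implicit Types (A B H K M N T : gset G).

(** Modulo the normal subgroup [A], a commutator of products ab and cd is the commutator of [b] and
    [d]. *)
Lemma derived_setmul A B H n : is_subgroup H -> normal A H -> is_subgroup B -> sub B H ->
  (forall h, H h -> exists a b, A a /\ B b /\ h = a ** b) ->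
  forall h, derived H n h -> exists a b, A a /\ derived B n b /\ h = a ** b.
Proof.
move=> sH nA sB sBH HAB; have [sA [sAH nAH]] := nA.
have [h1 [hM hV]] := sH.
elim: n => [|n IHn] //.
have sBn m : sub (derived B m) H.
  by apply: sub_trans sBH; apply: derived_sub.
apply: commg_sub.
  apply: setmul_subgroup => //; first exact: (derived_subgroup n.+1).
  by move=> a b Aa Bb; apply: nAH => //; apply: (sBn n.+1).
move=> _ _ /IHn[a [b [Aa [Bb ->]]]] /IHn[c [d [Ac [Bd ->]]]].
have [Hb Hd] : H b /\ H d by split; apply: (sBn n).
have [a1 [aM aV]] := sA.
have congAB x y : A x -> H y -> cong A y (x ** y).
  by move=> Ax Hy; have := nAH _ _ Ax Hy; rewrite /cong /conjg gmulA.
have E : cong A (commutator b d) (commutator (a ** b) (c ** d)).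
  have Kb := congAB _ _ Aa Hb; have Kd := congAB _ _ Ac Hd.
  apply: (cong_mul nA) => //; apply: (cong_mul nA) => //; apply: (cong_mul nA).
  - exact: hV.
  - exact: (cong_inv nA sH).
  exact: (cong_inv nA sH).
set e := commutator b d in E *; set z := commutator (a ** b) _ in E *.
(* [z] equals [e] times an element of [A]; conjugation by [e^v] moves that element to the left of
   [e]. *)
exists (conjg (e^v ** z) e^v), e; split.
  by apply: nAH => //; apply: hV; apply: commutator_in.
by split; [apply: commutator_in_commg | rewrite /conjg ginvK gmulKV -gmulA gmulV gmulr1].
Qed.

Section Perfect.
Variable T : gset G.
Hypotheses (sT : is_subgroup T) (pT : sub T (commg T T)).

Lemma perfect_derived n : sub T (derived T n).
Proof.
elim: n => [|n IHn] //; apply: sub_trans pT _; exact: commg_mono.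
Qed.

(** [T] equals its n-th derived subgroup, which lies in [A] times the n-th derived subgroup of [B];
    the latter is trivial for suitable n. *)
Lemma perfect_normal_soluble_supplement A B : normal A T -> is_subgroup B -> sub B T ->
  soluble B -> (forall h, T h -> exists a b, A a /\ B b /\ h = a ** b) -> sub T A.
Proof.
move=> nA sB sBT [n Bn1] TAB t /(perfect_derived n).
case/(derived_setmul sT nA sB sBT TAB) => a [b [Aa [/Bn1 -> ->]]].
by rewrite gmulr1.
Qed.

Hypotheses (nilT : ~ nilpotent T) (fgT : finitely_generated T).
Hypothesis normal_nil : forall N, normal N T -> ~ sub T N -> nilpotent N.

Let pnormal N := normal N T /\ ~ sub T N.

Lemma pnormal_trivial : pnormal trivial.
Proof.
split; last first.
  move=> T1; apply: nilT; exists 0%N; exact: T1.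
split; first by split=> //; split=> [x y -> -> | x ->]; rewrite /trivial ?gmul1 ?ginv1.
by split=> [x -> | x y -> _]; [case: sT | rewrite /trivial; group].
Qed.

(** The witness is the product AB. It is proper because [B] is nilpotent, hence soluble, and a
    soluble supplement would force [A] to be everything. *)
Lemma pnormal_join A B : pnormal A -> pnormal B ->
  exists C, pnormal C /\ sub A C /\ sub B C.
Proof.
move=> [nA pA] [nB pB]; have nilB := normal_nil nB pB.
have [sA [sAT nAT]] := nA; have [sB [sBT nBT]] := nB.
exists (fun x => exists a b, A a /\ B b /\ x = a ** b); split; last first.
  split=> x Ax; first by exists x, gone; rewrite gmulr1; split=> //; split=> //; case: sB.
  by exists gone, x; rewrite gmul1; split=> //; case: sA.
split; last first.
  move=> TAB; apply: pA; apply: (perfect_normal_soluble_supplement nA sB sBT) => //.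
  exact: nilpotent_soluble.
split; first by apply: setmul_subgroup => // a b Aa Bb; apply: nAT => //; apply: sBT.
have [_ [tM tV]] := sT.
split=> [_ [a [b [Aa [Bb ->]]]] | _ t [a [b [Aa [Bb ->]]]] Tt].
  by apply: tM; [apply: sAT | apply: sBT].
exists (conjg a t), (conjg b t); split; first exact: nAT.
by split; [exact: nBT | group].
Qed.

(** The proper normal subgroups are exactly the nilpotent normal ones, and they form a directed
    family, so their union is already a subgroup. *)
Lemma mem_Fitting x : Fitting T x <-> exists2 N, pnormal N & N x.
Proof.
split=> [|[N [nN pN] Nx]]; last first.
  by apply: mem_gen; exists N; split=> //; split=> //; apply: normal_nil.
apply: (@gen_sub _ _ (fun x => exists2 N, pnormal N & N x)); last first.
  move=> y [N [nN [nilN Ny]]]; exists N => //; split=> // TN.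
  by apply: nilT; apply: nilpotent_mono nilN.
split; first by exists trivial => //; exact: pnormal_trivial.
split=> [y z [N pN Ny] [M pM Mz] | y [N pN Ny]]; last first.
  by exists N => //; case: pN => [[[_ [_ nV]] _] _]; apply: nV.
have [C [pC [sNC sMC]]] := pnormal_join pN pM; exists C => //.
by case: pC => [[[_ [cM _]] _] _]; apply: cM; [apply: sNC | apply: sMC].
Qed.

(** If the Fitting subgroup were [T], directedness would put a finite generating set inside a single
    proper normal subgroup. *)
Lemma pnormal_Fitting : pnormal (Fitting T).
Proof.
split; last first.
  move=> TF; have [l [lT Tl]] := fgT.
  have [N [[nN pN] lN]] : exists N, pnormal N /\ forall x, List.In x l -> N x.
    have : forall x, List.In x l -> Fitting T x.
      by move=> x lx; apply: TF; apply: lT; apply: mem_gen.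
    elim: l {lT Tl} => [|a l IHl] lF; first by exists trivial; split=> //; exact: pnormal_trivial.
    have [|N [pN lN]] := IHl _; first by move=> x lx; apply: lF; right.
    have /mem_Fitting[M pM Ma] := lF a (or_introl erefl).
    have [C [pC [sNC sMC]]] := pnormal_join pN pM; exists C; split=> // x [<- | lx].
      exact: sMC.
    by apply: sNC; apply: lN.
  apply: pN => t /Tl; apply: gen_sub; last exact: lN.
  by case: nN.
split; first exact: gen_subgroup.
split=> [x /mem_Fitting[N [[_ [sNT _]] _] /sNT] // | x t /mem_Fitting[N pN Nx] Tt].
by apply/mem_Fitting; exists N => //; case: pN => [[_ [_ nNT]] _]; apply: nNT.
Qed.

Lemma quotient_Fitting_simple : quotient_nonabelian_simple T (Fitting T).
Proof.
have [nF pF] := pnormal_Fitting; have [sF [sFT _]] := nF.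
split=> //; split; first by split.
split; last by move=> TF; apply: pF; apply: sub_trans TF.
move=> K nK sFK; have [TK | nTK] := pselect (sub T K).
  by right; split=> //; case: nK => _ [].
by left; split=> // x Kx; apply/mem_Fitting; exists K.
Qed.

(** Zorn's lemma: finite generation keeps the union of a chain of proper subgroups proper. *)
Lemma exists_maximal_subgroup : exists M, maximal_subgroup M T.
Proof.
have [_ nT1] := pnormal_trivial; have [l [lT Tl]] := fgT.
pose P (A : gset G) := (forall x, ~ A x) \/ [/\ is_subgroup A, sub A T & ~ sub T A].
have [F FP totF | A [PA maxA]] := @classical_sets.Zorn_bigcup G P.
  have [[A0 [FA0 [x0 A0x0]]] | nex] := pselect (exists A, F A /\ exists x, A x); last first.
    by left=> x [A FA Ax]; apply: nex; exists A; split=> //; exists x.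
  have FP' A x : F A -> A x -> [/\ is_subgroup A, sub A T & ~ sub T A].
    by move=> /FP[nA /nA|].
  have [sA0 _ _] := FP' _ _ FA0 A0x0.
  have U1 : exists2 A, F A & A gone by exists A0 => //; case: sA0.
  right; split.
  - split; first exact: U1.
    split=> [x y [A FA Ax] [B FB By] | x [A FA Ax]]; last first.
      by exists A => //; have [[_ [_ aV]] _ _] := FP' _ _ FA Ax; apply: aV.
    have [sAB | sBA] := totF _ _ FA FB.
      by exists B => //; have [[_ [bM _]] _ _] := FP' _ _ FB By; apply: bM => //; apply: sAB.
    by exists A => //; have [[_ [aM _]] _ _] := FP' _ _ FA Ax; apply: aM => //; apply: sBA.
  - by move=> x [A FA Ax]; have [_ sAT _] := FP' _ _ FA Ax; apply: sAT.
  move=> TU; have [B [FB [B1 lB]]] :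
      exists B, F B /\ B gone /\ forall x, List.In x l -> B x.
    have {lT Tl}lU : forall x, List.In x l -> exists2 A, F A & A x.
      by move=> x lx; apply: TU; apply: lT; apply: mem_gen.
    elim: l lU => [|a l IHl] lU; first by case: U1 => A FA A1; exists A.
    have [|B [FB [B1 lB]]] := IHl _; first by move=> x lx; apply: lU; right.
    have [A FA Aa] := lU a (or_introl erefl).
    have [sBA | sAB] := totF _ _ FB FA.
      exists A; split=> //; split; first exact: sBA.
      by move=> x [<- // | lx]; apply: sBA; apply: lB.
    exists B; split=> //; split=> // x [<- | lx]; first exact: sAB.
    exact: lB.
  have [sB _ nTB] := FP' _ _ FB B1; apply: nTB => t /Tl.
  exact: gen_sub.
have [nA | [sA sAT nTA]] := PA.
  case: (maxA trivial); first by split=> [x /nA //|/(_ gone erefl)/nA].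
  by right; have [[s1 [sub1 _]] _] := pnormal_trivial; split.
exists A; split=> //; split=> // K sK sAK sKT.
have [sKA | nKA] := pselect (sub K A); first by left.
right; split=> //; apply: contrapT => nTK; apply: (maxA K); first by split.
by right.
Qed.

Lemma maximal_subgroup_preim_conjg M h :
  T h -> maximal_subgroup M T -> maximal_subgroup (fun x => M (conjg x h)) T.
Proof.
move=> Th [sM [[sMT nTM] maxM]]; have Thv : T h^v by case: sT => _ [_ tV]; apply: tV.
have conjK x : conjg (conjg x h) h^v = x by group.
have conjVK x : conjg (conjg x h^v) h = x by group.
split; first exact: preim_conjg_subgroup.
split.
  split=> [x /sMT Tx | TM]; first by rewrite -(conjK x); apply: conjg_in.
  by apply: nTM => x Tx; rewrite -(conjVK x); apply: TM; apply: conjg_in.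
move=> K sK sMK sKT.
have [| |[KM _]|[_ TK]] := maxM _ (preim_conjg_subgroup h^v sK).
- by move=> x Mx; apply: sMK; rewrite conjVK.
- by move=> x /sKT Tx; rewrite -(conjVK x); apply: conjg_in.
- by left; split=> // x Kx; apply: KM; rewrite conjK.
right; split=> // x Tx; rewrite -(conjK x); apply: TK; exact: conjg_in.
Qed.

(** A maximal subgroup not containing the Fitting subgroup would be a nilpotent, hence soluble,
    supplement to it. Conversely the Frattini subgroup is normal, and proper since maximal subgroups
    exist. *)
Lemma Fitting_eq_Frattini : minimal_non_nilpotent T -> seteq (Fitting T) (Frattini T).
Proof.
move=> [_ minT]; have [nF pF] := pnormal_Fitting; have [sF [sFT nFT]] := nF.
split=> [x Fx | x Phix].
  split=> [|M maxM]; first exact: sFT.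
  have [sM [pM maxM']] := maxM; have [sMT nTM] := pM.
  apply: contrapT => nMx; apply: pF.
  apply: (perfect_normal_soluble_supplement nF sM sMT).
    exact/nilpotent_soluble/minT.
  pose FM y := exists a b, Fitting T a /\ M b /\ y = a ** b.
  have sFM : is_subgroup FM.
    by apply: setmul_subgroup => // a b Fa Mb; apply: nFT => //; apply: sMT.
  have [| |[FMM _]|[_ TFM]] := maxM' FM sFM.
  - by move=> y My; exists gone, y; rewrite gmul1; split=> //; case: sF.
  - move=> _ [a [b [Fa [Mb ->]]]]; case: sT => _ [tM _].
    by apply: tM; [apply: sFT | apply: sMT].
  - case: nMx; apply: FMM; exists x, gone; rewrite gmulr1.
    by split=> //; split=> //; case: sM.
  exact: TFM.
apply/mem_Fitting; exists (Frattini T) => //; split; last first.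
  have [M maxM] := exists_maximal_subgroup; have [_ [[_ nTM] _]] := maxM.
  by move=> TPhi; apply: nTM => y /TPhi[_]; apply.
have [t1 [tM tV]] := sT; split.
  split; first by split=> // M [[]].
  split=> [y z [Ty My] [Tz Mz] | y [Ty My]].
    split=> [|M maxM]; first exact: tM.
    by have [[_ [mM _]] _] := maxM; apply: mM; [apply: My | apply: Mz].
  split=> [|M maxM]; first exact: tV.
  by have [[_ [_ mV]] _] := maxM; apply: mV; apply: My.
split=> [y [] //|y t [Ty My] Tt]; split=> [|M maxM]; first exact: conjg_in.
exact: My (maximal_subgroup_preim_conjg Tt maxM).
Qed.

End Perfect.
End Fitting.

(** * Para-nilpotent-Hamiltonian groups *)

Section ParaNilHamiltonian.
Variable G : Grp.
Hypothesis hP : para_nil_hamiltonian G.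
Implicit Types (H K X Y : gset G).

Local Notation T := (gamma (@whole G) 3).

Lemma overgroup_normal Y H : ~ nilpotent Y -> is_subgroup Y -> is_subgroup H ->
  proper_sub Y H -> normal H whole.
Proof.
move=> nY sY sH pYH; apply: contrapT => /(hP.2 H sH)[nH | [_ /(_ Y sY pYH)]//].
by apply: nY; apply: nilpotent_mono nH; case: pYH.
Qed.

Lemma gamma3_sub_normal Y : ~ nilpotent Y -> normal Y whole -> sub T Y.
Proof.
move=> nilY nY; have [sY _] := nY; apply: gamma3_sub_of_overgroups_normal => // L sL sYL.
have [sLY | nLY] := pselect (sub L Y); last by apply: (overgroup_normal nilY sY).
by have -> : L = Y by apply/funext=> x; apply/propext; split=> [/sLY | /sYL].
Qed.

Lemma gamma3_sub_overgroup Y H : ~ nilpotent Y -> is_subgroup Y -> is_subgroup H ->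
  proper_sub Y H -> sub T H.
Proof.
move=> nY sY sH pYH; apply: gamma3_sub_normal (overgroup_normal nY sY sH pYH).
by move=> nH; apply: nY; apply: nilpotent_mono nH; case: pYH.
Qed.

Hypothesis hS : ~ soluble (@whole G).

Lemma gamma3_subgroup : is_subgroup T.
Proof. exact: (lcs_subgroup 2 (whole_subgroup G)). Qed.

Lemma gamma3_normal : normal T whole.
Proof. exact: (normal_lcs 2 (whole_subgroup G)). Qed.

Lemma gamma3_insoluble : ~ soluble T.
Proof.
(* The second derived subgroup of [G] is contained in its third lower central term. *)
move=> sT; apply: hS; apply: (@soluble_derived _ _ 2).
by apply: soluble_mono sT; apply: commg_mono.
Qed.

Lemma derived_gamma3_insoluble : ~ soluble (commg T T).
Proof. by move=> s; apply: gamma3_insoluble; apply: (@soluble_derived _ _ 1). Qed.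

Lemma gamma3_not_nilpotent : ~ nilpotent T.
Proof. by move=> n; apply: gamma3_insoluble; apply: nilpotent_soluble n; exact: gamma3_subgroup. Qed.

Lemma gamma3_perfect : sub T (commg T T).
Proof.
have nT := gamma3_normal; apply: gamma3_sub_normal; last first.
  by apply: normal_commg => //; exact: whole_subgroup.
by move=> /(nilpotent_soluble (commg_subgroup T T)); exact: derived_gamma3_insoluble.
Qed.

Lemma gamma3_eq_gamma_inf : seteq T (gamma_inf (@whole G)).
Proof.
split=> [x Tx i _ | x]; last by apply; repeat constructor.
have lcsT n : sub T (lcs whole n).
  elim: n => [|n IHn] //; apply: sub_trans gamma3_perfect _.
  exact: commg_mono.
exact: lcsT.
Qed.

Lemma proper_normal_gamma3_nilpotent N : normal N T -> ~ sub T N -> nilpotent N.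
Proof.
move=> nN nTN; have [sN [sNT _]] := nN; apply: contrapT => nilN.
have [t [Tt nNt]] : exists t, T t /\ ~ N t.
  apply: contrapT => nex; apply: nTN => t Tt; apply: contrapT => nNt.
  by apply: nex; exists t.
have TA : sub T (adjoin N t).
  apply: (gamma3_sub_overgroup nilN sN); first exact: gen_subgroup.
  by split; [exact: sub_adjoin | move=> /(_ _ (@mem_adjoin _ N t))].
apply: nTN; apply: sub_trans gamma3_perfect _.
exact: (commg_sub_adjoin nN gamma3_subgroup Tt TA).
Qed.

Lemma finite_whole X : is_subgroup X -> finite_set X -> ~ nilpotent X ->
  finite_set (normal_closure whole X) -> finite_set (@whole G).
Proof.
move=> sX fX nX fN; set N := normal_closure whole X in fN.
have sXN : sub X N.
  by move=> x Xx; apply: mem_gen; exists x, gone; split=> //; split=> //; group.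
have nN x g : N x -> N (conjg x g).
  move: x; apply: (gen_sub (preim_conjg_subgroup g (gen_subgroup _))).
  move=> _ [x [h [Xx [_ ->]]]]; apply: mem_gen; exists x, (h ** g).
  by split=> //; split=> //; group.
have [Y [sY sYX mY]] := exists_minimal_non_nilpotent sX fX nX.
have fY := finite_sub sYX fX.
have solY := minimal_non_nilpotent_soluble sY fY mY.
have [l lN] := finite_exact fN.
(* Conjugacy classes of elements of [N] stay in the finite set [N], so the centralizer of [N] has
   finite index. *)
have [|R RP] := @finite_cocentralizer G l.
  by move=> x /lN Nx; apply: finite_sub fN => _ [g ->]; apply: nN.
pose C c := forall x, N x -> conjg x c = x.
have [sCY | nCY] := pselect (sub C Y).
  apply: finite_sub (finite_setmul fY (ex_intro _ R (fun _ Rr => Rr))) => g _.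
  have [c [r [Rr -> Cc]]] := RP g; exists c, r; split=> //.
  by apply: sCY => x /lN; apply: Cc.
have [c [Cc nYc]] : exists c, C c /\ ~ Y c.
  apply: contrapT => nex; apply: nCY => c Cc; apply: contrapT => nYc.
  by apply: nex; exists c.
(* As [c] centralizes [Y], the subgroup [H] is cyclic modulo [Y]; hence [commg T T] lies in the
   soluble group [Y]. *)
exfalso; pose H := adjoin Y c; have sH : is_subgroup H := gen_subgroup _.
have sYH : sub Y H by exact: sub_adjoin.
have Hc : H c by exact: mem_adjoin.
have TH : sub T H by apply: (gamma3_sub_overgroup mY.1 sY sH); split=> // /(_ _ Hc).
have nY : normal Y H.
  split=> //; split=> // y h Yy Hh; apply: (proj1 (_ : _ /\ Y (conjg y h^v))).
  move: h Hh y Yy; apply: gen_sub.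
    split; first by move=> z Yz; rewrite ginv1 /conjg ginv1 gmul1 gmulr1.
    split=> [a b Ya Yb z Yz | a Ya z Yz]; last by rewrite ginvK; have [] := Ya z Yz.
    have -> : conjg z (a ** b) = conjg (conjg z a) b by group.
    have -> : conjg z (a ** b)^v = conjg (conjg z b^v) a^v by group.
    by split; [apply Yb; apply Ya | apply Ya; apply Yb].
  move=> z [Yz | ->] w Yw.
    by split; apply: conjg_in => //; case: sY => _ [_ yV]; apply: yV.
  have Ew := Cc _ (sXN _ (sYX _ Yw)); rewrite Ew; split=> //.
  by rewrite -[w in conjg w _]Ew; have -> : conjg (conjg w c) c^v = w by group.
apply: derived_gamma3_insoluble; apply: soluble_mono solY.
apply: sub_trans (commg_mono TH TH) _.
exact: (commg_sub_adjoin nY sH Hc).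
Qed.

Lemma not_normal_conjg X : is_subgroup X -> ~ normal X whole ->
  exists x g, X x /\ ~ X (conjg x g).
Proof.
move=> sX nX; apply: contrapT => nex; apply: nX; split=> //; split=> // x g Xx _.
by apply: contrapT => nXg; apply: nex; exists x, g.
Qed.

Lemma finite_normal_closure X : is_subgroup X -> finite_set X -> ~ nilpotent X ->
  normal X whole \/ (~ normal X whole /\ normal X (normal_closure whole X)) ->
  finite_set (normal_closure whole X).
Proof.
move=> sX fX nX; set N := normal_closure whole X.
have memN x g : X x -> N (conjg x g).
  by move=> Xx; apply: mem_gen; exists x, g.
case=> [[_ [_ nXW]] | [nXW [_ [_ nXN]]]].
  by apply: finite_sub fX; apply: gen_sub => // _ [x [g [Xx [Wg ->]]]]; apply: nXW.
have [x [g [Xx nXg]]] := not_normal_conjg sX nXW.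
pose Xg y := X (conjg y g^v).
have sXg : is_subgroup Xg by apply: preim_conjg_subgroup.
have XgE y : Xg y -> exists2 z, X z & y = conjg z g.
  by move=> Xy; exists (conjg y g^v) => //; group.
(* The product of [X] and its conjugate [Xg] is a subgroup, since [Xg] lies in the normal closure,
   which normalizes [X]. *)
pose H y := exists a b, X a /\ Xg b /\ y = a ** b.
have sH : is_subgroup H.
  apply: setmul_subgroup => // a b Xa /XgE[z Xz ->]; apply: nXN => //.
  exact: memN.
have sXH : sub X H.
  by move=> y Xy; exists y, gone; rewrite gmulr1; split=> //; split=> //; case: sXg.
have nH : normal H whole.
  apply: (overgroup_normal nX sX sH); split=> // sHX; apply: nXg; apply: sHX.
  exists gone, (conjg x g); rewrite gmul1; split; first by case: sX.
  by split=> //; rewrite /Xg; have -> : conjg (conjg x g) g^v = x by group.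
have fH : finite_set H.
  apply: finite_setmul => //; apply: finite_sub (finite_map (conjg^~ g) fX) => y /XgE[z Xz ->].
  by exists z.
apply: finite_sub fH; apply: gen_sub => // _ [y [h [Xy [_ ->]]]].
by case: nH => _ [_]; apply => //; apply: sXH.
Qed.

Lemma gamma3_finitely_generated X : is_subgroup X -> finite_set X -> ~ nilpotent X ->
  ~ normal X whole -> finitely_generated T.
Proof.
move=> sX fX nilX nX; have [x [g [Xx nXg]]] := not_normal_conjg sX nX.
have solX : soluble X.
  apply: minimal_non_nilpotent_soluble => //.
  by case: (hP.2 X sX nX).
have [sT [_ nT]] := gamma3_normal.
pose H := adjoin X (conjg x g); have sH : is_subgroup H := gen_subgroup _.
have sXH : sub X H by exact: sub_adjoin.
pose TX z := exists t y, T t /\ X y /\ z = t ** y.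
have sTX : is_subgroup TX by apply: setmul_subgroup => // a b Ta _; apply: nT.
have sXTX : sub X TX.
  by move=> y Xy; exists gone, y; rewrite gmul1; split=> //; case: sT.
(* [TX] properly contains [X], because [T] is insoluble and [X] is soluble. Its normality puts the
   conjugate of [x] inside it. *)
have [_ [_ nTX]] : normal TX whole.
  apply: (overgroup_normal nilX sX sTX); split=> // sTXX.
  apply: gamma3_insoluble; apply: soluble_mono solX => t Tt.
  by apply: sTXX; exists t, gone; rewrite gmulr1; split=> //; split=> //; case: sX.
have sHTX : sub H TX.
  apply: gen_sub => // y [Xy | ->]; first exact: sXTX.
  by apply: nTX => //; apply: sXTX.
(* [X] itself serves as the finite set of coset representatives of [T] in [H], since [H] lies in
   [TX]. *)
apply: (@schreier _ _ X T _ fX sT sXH) => [|h /sHTX[t [y [Tt [Xy ->]]]]|].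
- by apply: finite_union => //; exact: finite_singleton.
- by exists t, y.
apply: (gamma3_sub_overgroup nilX sX sH); split=> // sHX.
by apply: nXg; apply: sHX; exact: mem_adjoin.
Qed.

End ParaNilHamiltonian.

Theorem mainTheorem13 (G : Grp) (X : gset G) :
  para_nil_hamiltonian G ->
  ~ soluble (@whole G) ->
  is_subgroup X -> finite_set X -> ~ nilpotent X ->
  (* (i) *)
  (finite_set (normal_closure whole X) -> finite_set (@whole G)) /\
  (* (ii) *)
  ((normal X whole \/ (~ normal X whole /\ normal X (normal_closure whole X))) ->
     finite_set (@whole G)) /\
  (* (iii) *)
  (~ finite_set (normal_closure whole X) ->
     seteq (gamma whole 3) (gamma_inf (@whole G)) /\
     finitely_generated (gamma (@whole G) 3) /\
     perfect (gamma (@whole G) 3) /\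
     ~ soluble (gamma (@whole G) 3) /\
     quotient_nonabelian_simple (gamma (@whole G) 3) (Fitting (gamma (@whole G) 3)) /\
     (minimal_non_nilpotent (gamma (@whole G) 3) ->
        seteq (Fitting (gamma (@whole G) 3)) (Frattini (gamma (@whole G) 3)))).
Proof.
move=> hP hS sX fX nilX.
have fin := finite_whole hP hS sX fX nilX.
have finN := finite_normal_closure hP sX fX nilX.
split=> //; split=> [/finN/fin // | infN].
have nX : ~ normal X whole by move=> nX; apply: infN; apply: finN; left.
have sT := gamma3_subgroup G; have pT := gamma3_perfect hP hS.
have nT := gamma3_not_nilpotent hS.
have fgT := gamma3_finitely_generated hP hS sX fX nilX nX.
have nilN := proper_normal_gamma3_nilpotent hP hS.
split; first exact: gamma3_eq_gamma_inf.
split=> //; split.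
  by split=> //; apply: commg_sub => // a b Ta Tb; apply: (commutator_in sT).
split; first exact: gamma3_insoluble.
split; first exact: quotient_Fitting_simple.
exact: Fitting_eq_Frattini.
Qed.
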